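(* Let $k,r,d$ be non-negative integers with $k\ge r>d$. Then, as formal power series in $x$, $$\sum_{n\ge k}{n\brace k}_{r,d}\,x^n = \frac{x^k}{\prod_{j=r}^{k}\bigl(1-(j-d)x\bigr)}.$$
   Context: For non-negative integers $n,k,r,d$ with $n\ge r$, ${n\brace k}_{r,d}$ (the $(r,d)$-Stirling number of the second kind) denotes the number of partitions of $\{1,\dots,n\}$ into $k$ non-empty subsets such that the elements $1,\dots,r$ lie in pairwise different subsets and any two distinct elements $i,j$ in the same subset satisfy $|i-j|>d$. *)

(* Defs.v *)
From HB Require Import structures.
From mathcomp Require Import all_boot all_order all_algebra.
From mathcomp Require Import boolp.

Set Implicit Arguments.
Unset Strict Implicit.
Unset Printing Implicit Defensive.

Import Order.TTheory GRing.Theory Num.Theory.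
Local Open Scope ring_scope.

(* R[[x]]: the constructor maps a sequence a to the formal series whose
   coefficient of x^n is a n. *)
Record fps (R : Type) : Type := Fps { fps_coef : nat -> R }.

Lemma fpsP (R : Type) (p q : fps R) : fps_coef p =1 fps_coef q -> p = q.
Proof. by case: p q => [a] [b] /= /funext ->. Qed.

HB.instance Definition _ (R : Type) := gen_eqMixin (fps R).
HB.instance Definition _ (R : Type) := gen_choiceMixin (fps R).

Section FpsZmodule.
Variable R : zmodType.
Implicit Types p q : fps R.

Definition fps_zero : fps R := Fps (fun=> 0).
Definition fps_opp p : fps R := Fps (fun n => - fps_coef p n).
Definition fps_add p q : fps R := Fps (fun n => fps_coef p n + fps_coef q n).

Lemma fps_addA : associative fps_add.
Proof. by move=> p q s; apply: fpsP => n /=; rewrite addrA. Qed.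

Lemma fps_addC : commutative fps_add.
Proof. by move=> p q; apply: fpsP => n /=; rewrite addrC. Qed.

Lemma fps_add0 : left_id fps_zero fps_add.
Proof. by move=> p; apply: fpsP => n /=; rewrite add0r. Qed.

Lemma fps_addN : left_inverse fps_zero fps_opp fps_add.
Proof. by move=> p; apply: fpsP => n /=; rewrite addNr. Qed.

HB.instance Definition _ :=
  GRing.isZmodule.Build (fps R) fps_addA fps_addC fps_add0 fps_addN.
End FpsZmodule.

Section FpsRing.
Variable R : comNzRingType.
Implicit Types p q : fps R.

Definition fps_one : fps R := Fps (fun n => (n == 0)%:R).

Definition fps_mul p q : fps R :=
  Fps (fun n => \sum_(i < n.+1) fps_coef p i * fps_coef q (n - i)).

Definition fps_trunc m p : {poly R} := \poly_(i < m) fps_coef p i.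

Lemma coef_fps_trunc m p n :
  (n < m)%N -> (fps_trunc m p)`_n = fps_coef p n.
Proof. by move=> lt_nm; rewrite coef_poly lt_nm. Qed.

Lemma fps_mul_trunc m p q n : (n < m)%N ->
  fps_coef (fps_mul p q) n = (fps_trunc m p * fps_trunc m q)`_n.
Proof.
move=> lt_nm; rewrite coefM; apply: eq_bigr => i _.
by rewrite !coef_fps_trunc // (leq_ltn_trans _ lt_nm) ?leq_subr // -ltnS.
Qed.

Lemma fps_mulA : associative fps_mul.
Proof.
move=> p q s; apply: fpsP => n.
transitivity (fps_trunc n.+1 p * fps_trunc n.+1 q * fps_trunc n.+1 s)`_n.
  rewrite -mulrA [RHS]coefM; apply: eq_bigr => i _.
  by rewrite coef_fps_trunc // -(@fps_mul_trunc n.+1) // ltnS leq_subr.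
rewrite coefM; apply: eq_bigr => i _.
by rewrite (@fps_mul_trunc n.+1) // coef_fps_trunc // ltnS leq_subr.
Qed.

Lemma fps_mulC : commutative fps_mul.
Proof.
by move=> p q; apply: fpsP => n; rewrite !(fps_mul_trunc _ _ (ltnSn n)) mulrC.
Qed.

Lemma fps_mul1 : left_id fps_one fps_mul.
Proof.
move=> p; apply: fpsP => n /=; rewrite big_ord_recl /= mul1r subn0.
by rewrite big1 ?addr0 // => i _; rewrite mul0r.
Qed.

Lemma fps_mulDl : left_distributive fps_mul (@fps_add R).
Proof.
move=> p q s; apply: fpsP => n /=; rewrite -big_split.
by apply: eq_bigr => i _; rewrite mulrDl.
Qed.

Lemma fps_one_neq0 : fps_one != 0.
Proof.
by apply/eqP => /(congr1 (fun p => fps_coef p 0)) /eqP; rewrite oner_eq0.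
Qed.

HB.instance Definition _ := GRing.Zmodule_isComNzRing.Build (fps R)
  fps_mulA fps_mulC fps_mul1 fps_mulDl fps_one_neq0.

Definition fpsX : fps R := Fps (fun n => (n == 1)%:R).

Lemma fps_coefM p q n :
  fps_coef (p * q) n = \sum_(i < n.+1) fps_coef p i * fps_coef q (n - i).
Proof. by []. Qed.
End FpsRing.

Section FpsUnitRing.
Variable R : comUnitRingType.
Implicit Types p q : fps R.

Definition fps_unit : {pred fps R} := fun p => fps_coef p 0 \is a GRing.unit.

(* The first n coefficients of the inverse of p: from p * q = 1,
   q_n = - p_0^-1 * \sum_(i < n) p_(n - i) * q_i for n > 0. *)
Fixpoint fps_inv_seq p n : seq R :=
  if n is m.+1 then
    let s := fps_inv_seq p m in
    rcons s (if m == 0 then (fps_coef p 0)^-1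
             else - (fps_coef p 0)^-1
                    * \sum_(i < m) fps_coef p (m - i) * s`_i)
  else [::].

Definition fps_inv p : fps R :=
  if p \in fps_unit then Fps (fun n => (fps_inv_seq p n.+1)`_n) else p.

Lemma size_fps_inv_seq p n : size (fps_inv_seq p n) = n.
Proof. by elim: n => //= n IHn; rewrite size_rcons IHn. Qed.

Lemma nth_fps_inv_seq p n i : (i < n)%N ->
  (fps_inv_seq p n)`_i = (fps_inv_seq p i.+1)`_i.
Proof.
elim: n => // n IHn; rewrite ltnS leq_eqVlt => /predU1P[-> // | lt_in].
by rewrite [LHS]nth_rcons size_fps_inv_seq lt_in IHn.
Qed.

Lemma fps_mulV : {in fps_unit, left_inverse 1 fps_inv *%R}.
Proof.
move=> p Up; rewrite /fps_inv Up; apply: fpsP => n.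
have {}Up : fps_coef p 0 \is a GRing.unit by [].
rewrite fps_coefM big_ord_recr /= subnn.
rewrite nth_rcons size_fps_inv_seq ltnn eqxx.
case: n => [|n]; first by rewrite big_ord0 add0r mulVr.
rewrite [X in _ + X]mulrC mulNr mulrN mulVKr //; apply/eqP.
rewrite subr_eq0; apply/eqP/eq_bigr => i _.
by rewrite mulrC -(@nth_fps_inv_seq p n.+1).
Qed.

Lemma fps_unitPl p q : q * p = 1 -> fps_unit p.
Proof.
move=> /(congr1 (fun s => fps_coef s 0)); rewrite fps_coefM big_ord1 /= => qp1.
by apply/unitrPr; exists (fps_coef q 0); rewrite mulrC.
Qed.

Lemma fps_inv_out : {in [predC fps_unit], fps_inv =1 id}.
Proof. by move=> p /negbTE nUp; rewrite /fps_inv nUp. Qed.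

HB.instance Definition _ := GRing.ComNzRing_hasMulInverse.Build (fps R)
  fps_mulV fps_unitPl fps_inv_out.
End FpsUnitRing.

(* The element i : 'I_n stands for the integer i + 1 of {1, ..., n}. *)
Definition heads_separated (n r : nat) (P : {set {set 'I_n}}) : bool :=
  [forall i : 'I_n, forall j : 'I_n,
    [&& (i < r)%N, (j < r)%N & i != j] ==> (pblock P i != pblock P j)].

Definition blocks_sparse (n d : nat) (P : {set {set 'I_n}}) : bool :=
  [forall B in P, forall i in B, forall j in B,
    (i != j) ==> (d < `|i%:Z - j%:Z|)%N].

Definition stirling2 (n k r d : nat) : nat :=
  #|[set P : {set {set 'I_n}} |
      [&& partition P [set: 'I_n], #|P| == k,
          heads_separated r P & blocks_sparse d P]]|.

(* Main.v *)
Require Import Defs.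
From HB Require Import structures.
From mathcomp Require Import all_boot all_order all_algebra zify.

Set Implicit Arguments.
Unset Strict Implicit.
Unset Printing Implicit Defensive.

Import GRing.Theory.

(** Join two elements i, j of {0, ..., n-1} by an edge when they may not share
    a block: when both are below r, or when |i - j| <= d.  The partitions
    counted by the (r,d)-Stirling number are then the partitions of the vertex
    set into k stable sets of this graph.

    The last vertex n of the graph on {0, ..., n} is simplicial when d <= r:
    its neighbours, which are all of {0, ..., n-1} if n < r and the d vertices
    n-d, ..., n-1 otherwise, form a clique.  Deleting a simplicial vertex x
    with c neighbours gives a recurrence for partitions into stable sets
    ([nstable_simplicial]): either x was alone in its block, or it was added to
    one of the blocks of a stable partition of the rest that avoid its
    neighbours.  Since a clique of size c meets exactly c blocks of a stable
    partition, k + 1 of them leave k + 1 - c choices.  Hence ([stirling2S]),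
    with S(n, k) the (r,d)-Stirling number and n >= r,
      S(n+1, k+1) = S(n, k) + (k + 1 - d) S(n, k+1).

    For the generating functions F_k of the columns this recurrence reads
    (1 - (k+1-d) X) F_(k+1) = X F_k when k >= r, and, because S(n, r-1) = 0 for
    n >= r, it gives (1 - (r-d) X) F_r = X^r for the first column.  The product
    formula follows by induction on k, the denominators being invertible series
    as their constant coefficient is 1. *)

(** * Partitions into stable sets of a graph *)

Section StablePartitions.
Variable T : finType.
Implicit Types (e : rel T) (x y : T) (B D N : {set T}) (P Q : {set {set T}}).

Definition stable e B := [forall i in B, forall j in B, (i != j) ==> ~~ e i j].

Definition stable_parts e D : {set {set {set T}}} :=
  [set P | partition P D & [forall B in P, stable e B]].

Definition nstable e D (k : nat) := #|[set P in stable_parts e D | #|P| == k]|.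

Lemma stableP e B :
  reflect {in B &, forall i j, i != j -> ~~ e i j} (stable e B).
Proof.
apply: (iffP idP) => [h i j iB jB nij | h].
  by move/forall_inP/(_ i iB)/forall_inP/(_ j jB)/implyP: h; apply.
apply/forall_inP => i iB; apply/forall_inP => j jB; apply/implyP.
exact: h.
Qed.

Lemma stable0 e : stable e set0.
Proof. by apply/stableP => i j; rewrite inE. Qed.

Lemma stableU1 e x B : symmetric e -> x \notin B ->
  stable e (x |: B) = stable e B && [disjoint B & [set y | e x y]].
Proof.
move=> sym_e xB; rewrite disjoint_subset.
apply/idP/andP => [/stableP h | [/stableP h /subsetP hx]].
  split.
    by apply/stableP => i j iB jB; apply: h; rewrite in_setU1 ?iB ?jB orbT.
  apply/subsetP => y yB; rewrite !inE.
  apply: h; rewrite ?setU11 ?setU1r //; apply: contraNneq xB => -> //.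
have hN y : y \in B -> ~~ e x y by move=> /hx; rewrite !inE.
apply/stableP => i j /setU1P[->|iB] /setU1P[->|jB].
- by rewrite eqxx.
- by move=> _; apply: hN.
- by move=> _; rewrite sym_e; apply: hN.
- exact: h.
Qed.

Lemma all_stableU1 e B P :
  [forall C in B |: P, stable e C] = stable e B && [forall C in P, stable e C].
Proof.
apply/forall_inP/andP => [h | [hB /forall_inP h] C /setU1P[-> //|/h //]].
split; first by apply: h; rewrite setU11.
by apply/forall_inP => C CP; apply: h; rewrite setU1r.
Qed.

(** Taking B = set0 makes x a block of its own, so that both ways of adding a
    point to a partition, in a new block or in the old block B, have the same
    description: a choice of B in [set0 |: Q]. *)
Definition insert_in x B Q := (x |: B) |: (Q :\ B).

Lemma part_setD0 Q D : partition Q D -> Q :\ set0 = Q.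
Proof.
move=> partQ; apply/setDidPl.
by rewrite disjoint_sym disjoints1 (partition0 partQ).
Qed.

Lemma part_setD1 Q D B :
  partition Q D -> B \in set0 |: Q -> partition (Q :\ B) (D :\: B).
Proof.
move=> partQ /setU1P[-> | BQ]; last exact: partitionD1.
by rewrite (part_setD0 partQ) setD0.
Qed.

Lemma insert_sub Q D B : partition Q D -> B \in set0 |: Q -> B \subset D.
Proof. by move=> partQ /setU1P[->|/(partitionS partQ)//]; apply: sub0set. Qed.

Lemma insert_partition x D Q B : x \notin D -> partition Q D ->
  B \in set0 |: Q -> partition (insert_in x B Q) (x |: D).
Proof.
move=> xD partQ BQ; have sBD := insert_sub partQ BQ.
have -> : x |: D = (x |: B) :|: (D :\: B).
  by rewrite -setUA -{1}(setID D B) (setIidPr sBD).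
apply: partitionU1; first exact: part_setD1.
  by apply/set0Pn; exists x; rewrite setU11.
rewrite disjoints_subset; apply/subsetP => y; rewrite !inE.
by case/predU1P => [-> | ->]; rewrite ?(negPf xD) ?andbF.
Qed.

Lemma insertK x D Q B : x \notin D -> partition Q D -> B \in set0 |: Q ->
  insert_in x B Q :\ (x |: B) = Q :\ B.
Proof.
move=> xD partQ BQ; apply: setU1K; apply: contra xD => xBQ.
have /subsetP := partitionS partQ (subsetP (subD1set _ _) _ xBQ).
by apply; rewrite setU11.
Qed.

Lemma insert_restore D Q B : partition Q D -> B \in set0 |: Q ->
  Q = if B == set0 then Q :\ B else B |: (Q :\ B).
Proof.
move=> partQ /setU1P[-> | BQ].
  by rewrite eqxx (part_setD0 partQ).
by rewrite (negPf (partition_neq0 partQ BQ)) setD1K.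
Qed.

(** The pair is read off the result: the block of x is [x |: B], and the other
    blocks are those of Q except B. *)
Lemma insert_inj x D Q B Q' B' : x \notin D ->
    partition Q D -> B \in set0 |: Q -> partition Q' D -> B' \in set0 |: Q' ->
  insert_in x B Q = insert_in x B' Q' -> (Q, B) = (Q', B').
Proof.
move=> xD pQ BQ pQ' BQ' eqI.
have blk C P : partition P D -> C \in set0 |: P ->
    pblock (insert_in x C P) x = x |: C.
  move=> pP CP; apply: def_pblock; rewrite ?setU11 //.
  exact: partition_trivIset (insert_partition xD pP CP).
have eqB : B = B'.
  have xn C P : partition P D -> C \in set0 |: P -> x \notin C.
    by move=> pP CP; apply: contra xD; apply/subsetP/(insert_sub pP CP).
  rewrite -(setU1K (xn _ _ pQ BQ)) -(setU1K (xn _ _ pQ' BQ')).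
  by rewrite -(blk _ _ pQ BQ) -(blk _ _ pQ' BQ') eqI.
congr (_, _) => //; rewrite (insert_restore pQ BQ) (insert_restore pQ' BQ').
by rewrite -(insertK xD pQ BQ) -(insertK xD pQ' BQ') eqI eqB.
Qed.

(** Q is obtained by removing x from its block, and dropping this block if it
    becomes empty. *)
Lemma insert_surj x D P : x \notin D -> partition P (x |: D) ->
  exists Q B, [/\ partition Q D, B \in set0 |: Q & P = insert_in x B Q].
Proof.
move=> xD partP; set A := pblock P x.
have xcov : x \in cover P by rewrite (cover_partition partP) setU11.
have xA : x \in A by rewrite mem_pblock.
have AP : A \in P by apply: pblock_mem.
have partA := partitionD1 partP AP.
have sAD : A :\ x \subset D.
  by rewrite subDset; apply: partitionS partP AP.
have DA : (x |: D) :\: A = D :\: (A :\ x).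
  apply/setP => y; rewrite !inE; case: eqVneq => [-> | //] /=.
  by rewrite xA (negPf xD).
(* The set A minus x cannot be another block, since it would meet A. *)
have nAx : A :\ x \notin P :\ A.
  apply/negP => /setD1P[neqA AxP].
  have /set0Pn[y yAx] := partition_neq0 partP AxP.
  have trP := partition_trivIset partP.
  case/eqP: neqA; rewrite -(def_pblock trP AxP yAx).
  by apply: def_pblock => //; case/setD1P: yAx.
case: (eqVneq (A :\ x) set0) => [A0 | A_neq0].
  exists (P :\ A), set0; rewrite setU11; split=> //.
    by move: partA; rewrite DA A0 setD0.
  rewrite /insert_in -A0 setD1K //.
  have -> : (P :\ A) :\ (A :\ x) = P :\ A.
    by apply/setDidPl; rewrite disjoint_sym disjoints1.
  by rewrite setD1K.
exists ((A :\ x) |: (P :\ A)), (A :\ x); split.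
- have -> : D = (A :\ x) :|: (D :\: (A :\ x)).
    by rewrite -{1}(setID D (A :\ x)) (setIidPr sAD).
  apply: partitionU1 => //; first by rewrite -DA.
  by rewrite disjoint_sym disjoints_subset subsetDr.
- by rewrite setU1r // setU11.
- by rewrite /insert_in setD1K // setU1K // setD1K.
Qed.

Lemma card_insert x D Q B : x \notin D -> partition Q D -> B \in set0 |: Q ->
  #|insert_in x B Q| = (B == set0) + #|Q|.
Proof.
move=> xD partQ BQ; rewrite (cardsD1 (x |: B)) setU11 (insertK xD partQ BQ).
case/setU1P: BQ => [-> | BQ].
  by rewrite eqxx [in RHS](cardsD1 set0) (partition0 partQ).
by rewrite [in RHS](cardsD1 B) BQ (negPf (partition_neq0 partQ BQ)).
Qed.

Lemma stable_insert e x D Q B : symmetric e -> x \notin D -> partition Q D ->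
    B \in set0 |: Q ->
  [forall C in insert_in x B Q, stable e C]
    = [forall C in Q, stable e C] && [disjoint B & [set y in D | e x y]].
Proof.
move=> sym_e xD partQ BQ; have sBD := insert_sub partQ BQ.
rewrite all_stableU1 stableU1 //; last by apply: contra xD; apply/subsetP.
have -> : [disjoint B & [set y | e x y]] = [disjoint B & [set y in D | e x y]].
  rewrite -!setI_eq0; congr (_ == _); apply/setP => y; rewrite !inE.
  by case: (boolP (y \in B)) => //= /(subsetP sBD) ->.
rewrite andbAC; congr (_ && _); case/setU1P: BQ => [-> | BQ].
  by rewrite stable0 (part_setD0 partQ).
by rewrite -all_stableU1 setD1K.
Qed.

(** Two points of a clique never share a stable block, so N meets exactly #|N|
    blocks. *)
Lemma card_blocks_off_clique e D Q N : partition Q D ->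
    [forall C in Q, stable e C] -> N \subset D ->
    {in N &, forall y z, y != z -> e y z} ->
  #|[set B in Q | [disjoint B & N]]| = #|Q| - #|N|.
Proof.
move=> partQ /forall_inP stQ sND cliqueN.
have inN y : y \in N -> y \in cover Q.
  by rewrite (cover_partition partQ); apply/subsetP.
have <- : #|[set pblock Q y | y in N]| = #|N|.
  apply: card_in_imset => y z yN zN eq_yz; apply: contraTeq isT => nyz.
  have /stableP := stQ _ (pblock_mem (inN _ yN)).
  move/(_ y z); rewrite mem_pblock inN // eq_yz mem_pblock inN //.
  by move=> /(_ isT isT nyz); rewrite cliqueN.
have sub : [set pblock Q y | y in N] \subset Q.
  by apply/subsetP => _ /imsetP[y yN ->]; apply: pblock_mem; apply: inN.
rewrite -{1}(setIidPr sub) -cardsD; apply: eq_card => B; rewrite !inE.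
have [BQ | //] := boolP (B \in Q); rewrite ?andbT ?andbF //.
apply: negb_inj; rewrite negbK; apply/idP/idP; last first.
  case/imsetP => y yN ->; apply/pred0Pn; exists y => /=.
  by rewrite mem_pblock inN.
case/pred0Pn => y /andP[/= yB yN]; apply/imsetP; exists y => //.
by rewrite (def_pblock _ BQ yB) // (partition_trivIset partQ).
Qed.

Lemma nstable_set0 e k : nstable e set0 k = (k == 0).
Proof.
rewrite /nstable /stable_parts.
have -> : [set P in [set P | partition P set0 & [forall B in P, stable e B]]
            | #|P| == k] = if k == 0 then [set set0] else set0.
  apply/setP => P; rewrite !inE partition_set0.
  case: (eqVneq P set0) => [->|nP] /=.
    rewrite cards0; have -> : [forall B in set0, stable e B].
      by apply/forall_inP => B; rewrite inE.
    by case: k => [|k]; rewrite !inE ?eqxx.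
  by case: ifP => _; rewrite !inE // (negPf nP).
by case: eqP; rewrite ?cards1 ?cards0.
Qed.

(** Deletion of a simplicial vertex x.  A stable partition of [x |: D] is a
    stable partition Q of D together with a set B in [set0 |: Q] avoiding the
    neighbours of x; it has one block more than Q if B is empty, and as many
    otherwise. *)
Lemma nstable_simplicial e D x k : symmetric e -> x \notin D ->
    {in [set y in D | e x y] &, forall y z, y != z -> e y z} ->
  nstable e (x |: D) k.+1
    = nstable e D k + (k.+1 - #|[set y in D | e x y]|) * nstable e D k.+1.
Proof.
move=> sym_e xD; set N := [set y in D | e x y] => cliqueN.
pose F Q := [set B in set0 |: Q |
              [disjoint B & N] & (B == set0) + #|Q| == k.+1].
pose pairs := [set p : {set {set T}} * {set T} |
                (p.1 \in stable_parts e D) && (p.2 \in F p.1)].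
have -> : nstable e (x |: D) k.+1 = #|pairs|.
  rewrite -(@card_in_imset _ _ (fun p => insert_in x p.2 p.1) (mem pairs)).
    congr #|pred_of_set _|; apply/setP => P; rewrite !inE; apply/idP/imsetP.
      case/andP => /andP[partP stP] cP.
      have [Q [B [pQ BQ eqP]]] := insert_surj xD partP.
      exists (Q, B) => //; move: stP cP; rewrite eqP !inE /= pQ.
      rewrite (stable_insert sym_e xD pQ BQ) (card_insert xD pQ BQ).
      move=> /andP[-> ->].
      by rewrite -in_setU1 BQ.
    case=> -[Q B]; rewrite !inE /= -in_setU1 => /andP[/andP[pQ stQ]].
    case/and3P=> BQ dBN cQ ->; rewrite insert_partition //.
    by rewrite (stable_insert sym_e xD pQ BQ) (card_insert xD pQ BQ) stQ dBN.
  move=> [Q B] [Q' B']; rewrite !inE /= -!in_setU1.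
  move=> /andP[/andP[pQ _] /andP[BQ _]] /andP[/andP[pQ' _] /andP[BQ' _]].
  exact: insert_inj xD pQ BQ pQ' BQ'.
(* A partition Q of k blocks only admits B = set0; one of k + 1 blocks admits
   those of its blocks that avoid the clique N. *)
have FE Q : Q \in stable_parts e D ->
  #|F Q| = (#|Q| == k) + (#|Q| == k.+1) * (k.+1 - #|N|).
  rewrite inE => /andP[pQ stQ].
  case: (eqVneq #|Q| k) => [cQ | nQk].
    rewrite cQ (ltn_eqF (ltnSn k)) mul0n.
    suff -> : F Q = [set set0] by rewrite cards1.
    apply/setP => B; rewrite !inE cQ.
    by case: eqVneq => [->|nB]; rewrite ?disjoints0 ?eqxx //=
      ?add0n ?(ltn_eqF (ltnSn k)) ?andbF // -setI_eq0 set0I eqxx.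
  case: (eqVneq #|Q| k.+1) => [cQ | nQk1].
    rewrite mul1n -{1}cQ -(card_blocks_off_clique pQ stQ _ cliqueN); last first.
      by apply/subsetP => y; rewrite inE => /andP[].
    apply: eq_card => B; rewrite !inE cQ.
    case: eqVneq => [->|nB] /=; last by rewrite eqxx andbT.
    by rewrite (partition0 pQ) (gtn_eqF (ltnSn k.+1)) andbF.
  suff -> : F Q = set0 by rewrite cards0.
  apply/setP => B; rewrite !inE; case: (B == set0); rewrite /= ?eqSS.
    by rewrite (negPf nQk) andbF.
  by rewrite add0n (negPf nQk1) !andbF.
have -> : #|pairs| = \sum_(Q in stable_parts e D) #|F Q|.
  rewrite -sum1dep_card -(pair_big_dep (fun Q => Q \in stable_parts e D)
     (fun Q B => B \in F Q) (fun _ _ => 1)) /=.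
  by apply: eq_bigr => Q _; rewrite sum1_card.
rewrite (eq_bigr _ FE) big_split -big_distrl /= mulnC.
have cnt j : \sum_(Q in stable_parts e D) (#|Q| == j : nat) = nstable e D j.
  by rewrite -big_mkcondr sum1dep_card.
by rewrite !cnt.
Qed.

End StablePartitions.

(** This carries the count on {0, ..., n-1}, embedded as the complement of the
    last element of {0, ..., n}, back to the type of elements below n. *)
Lemma nstable_imset (T T' : finType) (f : T -> T') (e : rel T') (D : {set T})
    (k : nat) :
  injective f -> nstable e (f @: D) k = nstable (relpre f e) D k.
Proof.
move=> inj_f; pose fP (P : {set {set T}}) := [set f @: (B : {set T}) | B in P].
have inj_fP : injective fP by apply/imset_inj/imset_inj.
have stf (B : {set T}) : stable e (f @: B) = stable (relpre f e) B.
  apply/stableP/stableP => h.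
    by move=> i j iB jB nij; apply: h; rewrite ?imset_f ?(inj_eq inj_f).
  move=> _ _ /imsetP[i iB ->] /imsetP[j jB ->]; rewrite (inj_eq inj_f).
  exact: h.
rewrite /nstable -(card_imset _ inj_fP); apply: eq_card => P.
have memE (Q : {set {set T}}) :
  (fP Q \in [set P in stable_parts e (f @: D) | #|P| == k])
    = (Q \in [set P in stable_parts (relpre f e) D | #|P| == k]).
  rewrite !inE imset_partition // card_imset; last exact: imset_inj.
  congr (_ && _ && _); apply/forall_inP/forall_inP => h.
    by move=> B BQ; rewrite -stf; apply: h; rewrite imset_f.
  by move=> _ /imsetP[B BQ ->]; rewrite stf; apply: h.
apply/idP/imsetP => [Pin | [Q Qin ->]]; last by rewrite memE.
have PE : P = fP [set f @^-1: (B : {set T'}) | B in P].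
  have pP : partition P (f @: D) by move: Pin; rewrite !inE => /andP[/andP[]].
  rewrite /fP -imset_comp -[LHS]imset_id; apply: eq_in_imset => B BP /=.
  apply/setP => y; apply/idP/imsetP => [yB | [z]]; last first.
    by rewrite inE => zB ->.
  have /imsetP[z _ yE] := subsetP (partitionS pP BP) y yB.
  by exists z; rewrite // inE -yE.
by exists [set f @^-1: (B : {set T'}) | B in P]; rewrite // -memE -PE.
Qed.

(** * The conflict graph of the Stirling numbers *)

(** With truncated subtractions, the second disjunct is |i - j| <= d. *)
Definition conflict (r d : nat) : rel nat :=
  fun i j => (i < r) && (j < r) || (i - j <= d) && (j - i <= d).

Lemma conflict_sym r d : symmetric (conflict r d).
Proof. by move=> i j; rewrite /conflict andbC [(_ <= d) && _]andbC. Qed.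

Lemma stirling2_nstable n k r d :
  stirling2 n k r d
    = nstable (fun i j : 'I_n => conflict r d i j) [set: 'I_n] k.
Proof.
apply: eq_card => P; rewrite !inE -andbA.
case: (boolP (partition P _)) => //= pP.
rewrite [RHS]andbC; congr (_ && _).
have trP := partition_trivIset pP.
have cov i : i \in cover P by rewrite (cover_partition pP) inE.
apply/andP/forall_inP => [[/forallP hs /forall_inP bs] B BP | h].
  apply/stableP => i j iB jB nij; rewrite negb_or.
  have /forallP/(_ j)/implyP hsij := hs i; apply/andP; split.
    apply/negP => /andP[ir jr]; have := hsij; rewrite ir jr nij => /(_ isT).
    by rewrite (def_pblock trP BP iB) (def_pblock trP BP jB) eqxx.
  move/forall_inP/(_ i iB)/forall_inP/(_ j jB)/implyP/(_ nij): (bs B BP).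
  by lia.
split.
  apply/forallP => i; apply/forallP => j; apply/implyP => /and3P[ir jr nij].
  apply/eqP => eqij; have /stableP/(_ i j) := h _ (pblock_mem (cov i)).
  rewrite mem_pblock cov eqij mem_pblock cov => /(_ isT isT nij).
  by rewrite /conflict ir jr.
apply/forall_inP => B BP; apply/forall_inP => i iB; apply/forall_inP => j jB.
apply/implyP => nij; have /stableP/(_ i j iB jB nij) := h B BP.
by rewrite /conflict; lia.
Qed.

(** The vertex n is simplicial in the graph on {0, ..., n}.  If n < r, both
    neighbours are below r; otherwise both lie between n - d and n - 1, hence
    at distance less than d. *)
Lemma conflict_clique r d n i j : d <= r -> i < n -> j < n ->
  conflict r d n i -> conflict r d n j -> conflict r d i j.
Proof. by rewrite /conflict; lia. Qed.

(** For n >= r the assumption d <= r ensures that n has d predecessors. *)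
Lemma card_conflict r d n : d <= r ->
  #|[set i : 'I_n | conflict r d n i]| = if n < r then n else d.
Proof.
move=> le_dr; have [lt_nr | le_rn] := ltnP n r.
  suff -> : [set i : 'I_n | conflict r d n i] = [set: 'I_n].
    by rewrite cardsT card_ord.
  apply/setP => i; rewrite !inE /conflict; have := ltn_ord i.
  by rewrite lt_nr => /ltn_trans->.
transitivity (\sum_(n - d <= i < n) 1); last first.
  by rewrite sum_nat_const_nat muln1 subKn // (leq_trans le_dr).
rewrite -sum1dep_card big_geq_mkord; apply: eq_bigl => i.
by have := ltn_ord i; rewrite /conflict; lia.
Qed.

Lemma stirling2_0 k r d : stirling2 0 k r d = (k == 0).
Proof.
rewrite stirling2_nstable -(nstable_set0 (fun i j : 'I_0 => conflict r d i j) k).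
by congr nstable; apply/setP => -[].
Qed.

Lemma stirling2S n k r d : d <= r ->
  stirling2 n.+1 k.+1 r d
    = stirling2 n k r d
      + (k.+1 - (if n < r then n else d)) * stirling2 n k.+1 r d.
Proof.
move=> le_dr; rewrite !stirling2_nstable.
pose e (i j : 'I_n.+1) := conflict r d i j.
pose f : 'I_n -> 'I_n.+1 := lift ord_max.
have inj_f : injective f by apply: lift_inj.
have fE i : f i = i :> nat by rewrite /= /bump leqNgt ltn_ord.
have relE : relpre f e = (fun i j : 'I_n => conflict r d i j) :> rel 'I_n.
  by apply: boolp.funext => i; apply: boolp.funext => j; rewrite /= /e !fE.
have -> : [set: 'I_n.+1] = ord_max |: f @: [set: 'I_n].
  apply/setP => i; rewrite !inE; apply/esym.
  by case: (unliftP ord_max i) => [j -> | ->]; rewrite ?eqxx ?imset_f ?orbT.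
have nmax : ord_max \notin f @: [set: 'I_n].
  by apply/imsetP => -[i _ /eqP]; rewrite (negPf (neq_lift _ _)).
have nbE : [set y in f @: [set: 'I_n] | e ord_max y]
            = f @: [set i : 'I_n | conflict r d n i].
  apply/setP => y; rewrite !inE; apply/andP/imsetP.
    by case=> /imsetP[i _ ->]; rewrite /e fE => eni; exists i; rewrite ?inE.
  by case=> i; rewrite inE => eni ->; rewrite imset_f // /e fE.
rewrite (nstable_simplicial _ _ nmax).
- rewrite nbE (card_imset _ inj_f) card_conflict //.
  by rewrite !(nstable_imset e _ _ inj_f) relE.
- by move=> i j; apply: conflict_sym.
rewrite nbE => _ _ /imsetP[i + ->] /imsetP[j + ->] _; rewrite !inE /e !fE.
exact: conflict_clique.
Qed.

Lemma stirling2_lt n k r d : d <= r -> n < k -> stirling2 n k r d = 0.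
Proof.
move=> le_dr; elim: n k => [|n IHn] [|k] //; first by rewrite stirling2_0.
by rewrite ltnS => lt_nk; rewrite stirling2S // !IHn ?muln0 // ltnW.
Qed.

(** The first r elements lie in different blocks, so fewer than r blocks cannot
    accommodate r elements; nor can k < r blocks accommodate n elements when
    k < n <= r.  In the induction on n both terms of the recurrence vanish by
    hypothesis, except the second one when k + 1 = n, and there n < r makes the
    coefficient k + 1 - n vanish. *)
Lemma stirling2_few n k r d : d <= r -> k < r -> k < n -> stirling2 n k r d = 0.
Proof.
move=> le_dr; elim: n k => [|n IHn] [|k] // lt_kr lt_kn.
  apply: eq_card0 => P; rewrite !inE; apply: contraTF lt_kn.
  case/and4P => pP /eqP/cards0_eq P0 _ _; move: pP; rewrite P0.
  move/cover_partition; rewrite /cover big_set0 => /setP/(_ ord_max).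
  by rewrite !inE.
rewrite stirling2S // (IHn k (ltnW lt_kr) lt_kn) add0n.
move: lt_kn; rewrite ltnS leq_eqVlt => /predU1P[<- | lt_kn].
  by rewrite lt_kr subnn.
by rewrite IHn ?muln0.
Qed.

Lemma stirling2_diag n r d : d <= r -> stirling2 n n r d = 1.
Proof.
move=> le_dr; elim: n => [|n IHn]; first by rewrite stirling2_0.
by rewrite stirling2S // IHn stirling2_lt // muln0.
Qed.

(** * Generating functions *)

Local Open Scope ring_scope.

Lemma fps_coef_natmul (R : comNzRingType) (p : fps R) m n :
  fps_coef (p *+ m) n = fps_coef p n *+ m.
Proof. by elim: m => // m IHm; rewrite !mulrS -IHm. Qed.

Lemma fps_coef_mulX (R : comNzRingType) (p : fps R) n :
  fps_coef (fpsX R * p) n = if n is m.+1 then fps_coef p m else 0.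
Proof.
rewrite fps_coefM big_ord_recl /= mul0r add0r.
case: n => [|n]; first by rewrite big_ord0.
rewrite big_ord_recl /= mul1r big1 ?addr0 ?subSS ?subn0 // => i _.
by rewrite mul0r.
Qed.

Lemma fps_coef_mul_lin (R : comNzRingType) (p : fps R) m n :
  fps_coef ((1 - m%:R * fpsX R) * p) n
    = fps_coef p n - (if n is n'.+1 then fps_coef p n' else 0) *+ m.
Proof.
rewrite mulrBl mul1r -mulrA mulr_natl -fps_coef_mulX -fps_coef_natmul.
by [].
Qed.

Lemma fps_lin_unit (R : comUnitRingType) m :
  1 - m%:R * fpsX R \is a @GRing.unit (fps R).
Proof.
have : fps_unit (1 - m%:R * fpsX R).
  have := fps_coef_mul_lin (1 : fps R) m 0.
  by rewrite mulr1 mul0rn subr0 /fps_unit => ->; apply: unitr1.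
by [].
Qed.

Definition stirling2_gf r d k : fps int :=
  Fps (fun n => (stirling2 n k r d)%:Z).

(** Comparing coefficients of X^(n+1) gives the recurrence for n >= r; for
    n < r <= k all the coefficients involved are zero. *)
Lemma stirling2_gfS k r d : (d < r)%N -> (r <= k)%N ->
  (1 - (k.+1 - d)%:R * fpsX int) * stirling2_gf r d k.+1
    = fpsX int * stirling2_gf r d k.
Proof.
move=> lt_dr le_rk; have le_dr := ltnW lt_dr.
apply: fpsP => n; rewrite fps_coef_mul_lin fps_coef_mulX.
case: n => [|n] /=; first by rewrite stirling2_0 mul0rn subr0.
have [lt_nr | le_rn] := ltnP n r.
  have lt_nk := leq_trans lt_nr le_rk.
  by rewrite !stirling2_lt ?mul0rn ?subr0 // ltnW.
by rewrite stirling2S // ltnNge le_rn /= PoszD PoszM -mulr_natl natz addrK.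
Qed.

(** Here the term S(n, r-1) of the recurrence vanishes for n >= r, so that only
    the coefficient S(r, r) = 1 survives on the right. *)
Lemma stirling2_gf_base r d : (d < r)%N ->
  (1 - (r - d)%:R * fpsX int) * stirling2_gf r d r = fpsX int ^+ r.
Proof.
move=> lt_dr; have le_dr := ltnW lt_dr.
have coefXn m n : fps_coef (fpsX int ^+ m) n = (n == m)%:R.
  elim: m n => [|m IHm] n; first by rewrite expr0.
  by rewrite exprS fps_coef_mulX; case: n.
apply: fpsP => n; rewrite fps_coef_mul_lin coefXn.
case: r lt_dr le_dr => // r lt_dr le_dr.
case: n => [|n] /=; first by rewrite stirling2_0 mul0rn subr0.
rewrite eqSS; case: (ltngtP n r) => [lt_nr | lt_rn | ->].
- by rewrite !stirling2_lt ?mul0rn ?subr0 // ltnW.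
- rewrite stirling2S // (stirling2_few (k := r)) // add0n ltnNge lt_rn /=.
  by rewrite PoszM -[_ *+ (_ - _)]mulr_natl natz subrr.
- by rewrite stirling2_diag // stirling2_lt // mul0rn subr0.
Qed.

Unset Implicit Arguments.

Theorem theorem1p8 (k r d : nat) (hrk : (r <= k)%N) (hdr : (d < r)%N) :
  Fps (fun n : nat => if (k <= n)%N then (stirling2 n k r d)%:Z else 0)
  = fpsX int ^+ k
    / \prod_(r <= j < k.+1) (1 - (j%:R - d%:R) * fpsX int) :> fps int.
Proof.
have -> : Fps (fun n : nat => if (k <= n)%N then (stirling2 n k r d)%:Z else 0)
            = stirling2_gf r d k.
  apply: fpsP => n /=; case: leqP => // lt_nk.
  by rewrite stirling2_lt // ltnW.
have -> : \prod_(r <= j < k.+1) (1 - (j%:R - d%:R) * fpsX int)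
            = \prod_(r <= j < k.+1) (1 - (j - d)%:R * fpsX int) :> fps int.
  apply: eq_big_nat => j /andP[rj _].
  by rewrite natrB // (leq_trans (ltnW hdr)).
apply: (canRL (mulrK _)).
  by elim/big_rec: _ => [|j p _ Up]; rewrite ?unitr1 // unitrM fps_lin_unit.
elim: k hrk => [|k IHk].
  by rewrite leqn0 => /eqP r0; rewrite r0 in hdr.
rewrite leq_eqVlt => /predU1P[<- | lt_rk].
  by rewrite big_nat1 mulrC stirling2_gf_base.
rewrite big_nat_recr /=; last exact: ltnW.
rewrite mulrCA [_ * (1 - _)]mulrC.
by rewrite stirling2_gfS // mulrCA [_ * stirling2_gf _ _ _]mulrC IHk // exprS.
Qed.
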